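(* Consider the client selection problem and the COCS policy described in the context, and suppose the Hölder condition holds with constants $L>0$, $\alpha>0$. Let $z=\frac{2\alpha}{3\alpha+2}\in(0,1)$, $\gamma=\frac{z}{2\alpha}$, $\theta=-\frac z2$, $A=\frac{2NMB}{c^{\min}}+\frac{2NMB}{c^{\min}}L2^{\alpha/2}$, and run COCS with $K(t)=t^{z}\log(t)$ and $h_T=\lceil T^{\gamma}\rceil$. Then $$\mathbb{E}[R(T)]\le \frac{4N^2MB}{c^{\min}}\Big(\log(T)T^{\frac{2\alpha+2}{3\alpha+2}}+T^{\frac{2}{3\alpha+2}}\Big)+\frac{NMB}{c^{\min}}\Big(\sum_{k=1}^{B/c^{\min}}\binom{N}{k}\Big)\frac{\pi^2}{3}+\Big(3L2^{\alpha/2}+\frac{2+2L2^{\alpha/2}}{(2\alpha+2)/(3\alpha+2)}\Big)\frac{NMB}{c^{\min}}T^{\frac{2\alpha+2}{3\alpha+2}},$$ where $c^{\min}=\min_{n,t}c_n(y_n^t)$. In particular, $\mathbb{E}[R(T)]=O\big(\frac{4N^2MB}{c^{\min}}T^{\frac{2\alpha+2}{3\alpha+2}}\log(T)\big)$.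
   Context: Setting. There are $N$ clients indexed by $\mathcal N=\{1,\dots,N\}$, $M$ edge servers (ESs) indexed by $\mathcal M=\{1,\dots,M\}$, and rounds $t=1,\dots,T$. In round $t$, ES $m$ can communicate with a set $\mathcal N_m^t\subseteq\mathcal N$ of clients (these sets may overlap). Each client $n$ reveals computation resources $y_n^t$ and charges a cost $c_n(y_n^t)>0$, with $c_n$ nondecreasing; $c^{\min}=\min_{n,t}c_n(y_n^t)$. Each ES has budget $B>0$. A feasible client selection decision in round $t$ is $\bm s^t=(\bm s_1^t,\dots,\bm s_M^t)$ with $\bm s_m^t\subseteq\mathcal N_m^t$, $\sum_{n\in\bm s_m^t}c_n(y_n^t)\le B$ for every $m$, and $\bm s_m^t\cap\bm s_{m'}^t=\emptyset$ for $m\neq m'$. Each client-ES pair $(n,m)$ with $n\in\mathcal N_m^t$ has an observed context $\phi_{n,m}^t\in\Phi=[0,1]^2$. If client $n$ is selected by ES $m$ in round $t$, its participation indicator $X_{n,m}^t\in\{0,1\}$ is Bernoulli with mean $p_{n,m}(\phi_{n,m}^t)$, where $p_{n,m}:\Phi\to[0,1]$ is unknown. The utility is $\mu(\bm s^t;\bm X^t)=\frac1M\sum_{m\in\mathcal M}\sum_{n\in\bm s_m^t}X_{n,m}^t$ (and $\mu(\bm s;\bm p^t)$ is the same with $p_{n,m}(\phi^t_{n,m})$ in place of $X^t_{n,m}$). The oracle decision $\bm s^{\mathrm{opt},t}$ maximizes $\mu(\bm s;\bm p^t)$ over feasible decisions. The expected regret of the policy choosing $\bm s^1,\dots,\bm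 s^T$ is $\mathbb E[R(T)]=\sum_{t=1}^T(\mathbb E[\mu(\bm s^{\mathrm{opt},t};\bm X^t)]-\mathbb E[\mu(\bm s^t;\bm X^t)])$. Hölder condition: there exist $L>0,\alpha>0$ with $|p_{n,m}(\phi)-p_{n,m}(\phi')|\le L\|\phi-\phi'\|^{\alpha}$ for all $\phi,\phi'\in\Phi$ and all pairs $(n,m)$ (Euclidean norm). COCS policy (inputs: increasing function $K$, integer $h_T$). Partition $\Phi$ into $h_T^2$ squares of side $1/h_T$. For each pair $(n,m)$ and square $l$ keep a counter $C_{n,m}(l)$ (initially $0$) and an estimate $\hat p_{n,m}(l)$ equal to the sample mean of indicators observed when $n$ was selected by $m$ with context in $l$. In round $t$: observe contexts, let $l^t_{n,m}$ be the square containing $\phi^t_{n,m}$, set $\hat X^t_{n,m}=\hat p_{n,m}(l^t_{n,m})$; a pair is under-explored if $C_{n,m}(l^t_{n,m})\le K(t)$. If an under-explored pair exists (exploration round), select a feasible decision that first maximizes the number of selected under-explored clients and then spends remaining per-ES budget on explored clients maximizing $\mu(\cdot;\hat{\bm X}^t)$. Otherwise (exploitation round), select a feasible $\bm s^t$ maximizing $\mu(\bm s;\hat{\bm X}^t)$. At the end of the round, for each selected pair observe $X^t_{n,m}$ and update $\hat p_{n,m}(l^t_{n,m})$ (running mean) and $C_{n,m}(l^t_{n,m})$ (increment). *)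

(* Defs.v *)
From mathcomp Require Import all_boot all_order all_algebra.
From mathcomp Require Import all_classical all_reals all_analysis.
Set Implicit Arguments. Unset Strict Implicit. Unset Printing Implicit Defensive.
Import Order.TTheory GRing.Theory Num.Theory.
Local Open Scope ring_scope.

(* Rounds are numbered t = 1..T; in finite types round t is the ordinal i with
   t = i.+1.  Clients are 'I_N, edge servers are 'I_M. *)

Definition decision (N M : nat) := {ffun 'I_M -> {set 'I_N}}.

(* Joint realisation of all participation indicators X^t_{n,m} for t=1..T. *)
Definition outcome (T N M : nat) := {ffun 'I_T -> {ffun 'I_N * 'I_M -> bool}}.

Definition feasible (R : realType) (N M : nat) (Nset : 'I_M -> {set 'I_N})
  (cost : 'I_N -> R) (B : R) (s : decision N M) : Prop :=
  (forall m, s m \subset Nset m) /\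
  (forall m, \sum_(n in s m) cost n <= B) /\
  (forall m m', m != m' -> [disjoint s m & s m']).

Definition utility (R : realType) (N M : nat) (s : decision N M)
  (X : 'I_N -> 'I_M -> R) : R :=
  (M%:R)^-1 * \sum_(m < M) \sum_(n in s m) X n m.

Definition dist2 (R : realType) (u v : R * R) : R :=
  Num.sqrt ((u.1 - v.1) ^+ 2 + (u.2 - v.2) ^+ 2).

Definition in_Phi (R : realType) (u : R * R) : Prop :=
  0 <= u.1 <= 1 /\ 0 <= u.2 <= 1.

(* Index (i,j), 0 <= i,j < h, of the square of side 1/h containing u in [0,1]^2
   (squares [i/h,(i+1)/h) x [j/h,(j+1)/h), the last ones closed at 1). *)
Definition cell (R : realType) (h : nat) (u : R * R) : nat * nat :=
  (minn (Num.truncn (u.1 * h%:R)) h.-1, minn (Num.truncn (u.2 * h%:R)) h.-1).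

Section COCS.
Variables (R : realType) (T N M : nat).
Variable (sel : 'I_T -> outcome T N M -> decision N M).
Variable (ctx : nat -> 'I_N -> 'I_M -> R * R).
Variable (h : nat).

Definition counter (w : outcome T N M) (i : 'I_T) (n : 'I_N) (m : 'I_M)
  (l : nat * nat) : nat :=
  #|[set j : 'I_T | [&& (j < i)%N, n \in sel j w m & cell h (ctx j.+1 n m) == l]]|.

(* hat p_{n,m}(l): sample mean of the observed indicators (0 if no sample). *)
Definition estimate (w : outcome T N M) (i : 'I_T) (n : 'I_N) (m : 'I_M)
  (l : nat * nat) : R :=
  (\sum_(j : 'I_T | [&& (j < i)%N, n \in sel j w m & cell h (ctx j.+1 n m) == l])
      ((w j (n, m) : nat)%:R)) / (counter w i n m l)%:R.

Definition Xhat (w : outcome T N M) (i : 'I_T) (n : 'I_N) (m : 'I_M) : R :=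
  estimate w i n m (cell h (ctx i.+1 n m)).

Variable (Nset : nat -> 'I_M -> {set 'I_N}).
Variable (K : nat -> R).

Definition under_explored (w : outcome T N M) (i : 'I_T) (n : 'I_N) (m : 'I_M)
  : bool :=
  (n \in Nset i.+1 m) && ((counter w i n m (cell h (ctx i.+1 n m)))%:R <= K i.+1).

Definition n_under (w : outcome T N M) (i : 'I_T) (s : decision N M) : nat :=
  #|[set nm : 'I_N * 'I_M | (nm.1 \in s nm.2) && under_explored w i nm.1 nm.2]|.

Variables (cost : nat -> 'I_N -> R) (B : R).

(* COCS: non-anticipating (decisions depend only on the observed history) and,
   in every round, an exploration or exploitation decision as described. *)
Definition cocs_policy : Prop :=
  (forall (i : 'I_T) (w w' : outcome T N M),
     (forall j : 'I_T, (j < i)%N -> forall n m, n \in sel j w m ->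
        w j (n, m) = w' j (n, m)) ->
     sel i w = sel i w') /\
  (forall (i : 'I_T) (w : outcome T N M),
    let s := sel i w in
    let feas := feasible (Nset i.+1) (cost i.+1) B in
    feas s /\
    if [exists nm : 'I_N * 'I_M, under_explored w i nm.1 nm.2] then
      (forall s', feas s' -> (n_under w i s' <= n_under w i s)%N) /\
      (forall s', feas s' ->
         (forall m, [set n in s' m | under_explored w i n m]
                    = [set n in s m | under_explored w i n m]) ->
         utility s' (fun n m => if under_explored w i n m then 0 else Xhat w i n m)
         <= utility s (fun n m => if under_explored w i n m then 0 else Xhat w i n m))
    else
      (forall s', feas s' -> utility s' (Xhat w i) <= utility s (Xhat w i))).
End COCS.

(* Probability of a joint realisation: independent Bernoulli indicators
   X^t_{n,m} with mean p_{n,m}(phi^t_{n,m}). *)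
Definition prob (R : realType) (T N M : nat) (p : 'I_N -> 'I_M -> R * R -> R)
  (ctx : nat -> 'I_N -> 'I_M -> R * R) (w : outcome T N M) : R :=
  \prod_(j : 'I_T) \prod_(nm : 'I_N * 'I_M)
     (if w j nm then p nm.1 nm.2 (ctx j.+1 nm.1 nm.2)
      else 1 - p nm.1 nm.2 (ctx j.+1 nm.1 nm.2)).

Definition expect (R : realType) (T N M : nat) (p : 'I_N -> 'I_M -> R * R -> R)
  (ctx : nat -> 'I_N -> 'I_M -> R * R) (f : outcome T N M -> R) : R :=
  \sum_(w : outcome T N M) prob p ctx w * f w.

Definition Xobs (R : realType) (T N M : nat) (w : outcome T N M) (i : 'I_T)
  : 'I_N -> 'I_M -> R := fun n m => ((w i (n, m) : nat)%:R).

Definition expected_regret (R : realType) (T N M : nat)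
  (p : 'I_N -> 'I_M -> R * R -> R) (ctx : nat -> 'I_N -> 'I_M -> R * R)
  (sopt : nat -> decision N M) (sel : 'I_T -> outcome T N M -> decision N M) : R :=
  \sum_(i < T)
    (expect p ctx (fun w => utility (sopt i.+1) (@Xobs R T N M w i))
     - expect p ctx (fun w => utility (sel i w) (@Xobs R T N M w i))).

Definition is_cmin (R : realType) (T N : nat) (cost : nat -> 'I_N -> R) (cmin : R)
  : Prop :=
  (exists t n, (1 <= t <= T)%N /\ cmin = cost t n) /\
  (forall t n, (1 <= t <= T)%N -> cmin <= cost t n).

Definition z_par (R : realType) (alpha : R) : R := 2 * alpha / (3 * alpha + 2).
Definition gamma_par (R : realType) (alpha : R) : R := z_par alpha / (2 * alpha).
Definition theta_par (R : realType) (alpha : R) : R := - (z_par alpha / 2).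

Definition K_cocs (R : realType) (alpha : R) (t : nat) : R :=
  powR (t%:R) (z_par alpha) * ln (t%:R).

Definition h_cocs (R : realType) (alpha : R) (T : nat) : nat :=
  `|Num.ceil (powR (T%:R) (gamma_par alpha))|%N.

Definition regret_bound (R : realType) (N M T : nat) (B L alpha cmin : R) : R :=
  let e := (2 * alpha + 2) / (3 * alpha + 2) in
  let LL := L * powR 2 (alpha / 2) in
  4 * (N%:R) ^+ 2 * M%:R * B / cmin *
    (ln (T%:R) * powR (T%:R) e + powR (T%:R) (2 / (3 * alpha + 2)))
  + N%:R * M%:R * B / cmin *
    (\sum_(1 <= k < (Num.truncn (B / cmin)).+1) ('C(N, k))%:R) * (pi ^+ 2 / 3)
  + (3 * LL + (2 + 2 * LL) / e) * (N%:R * M%:R * B / cmin) * powR (T%:R) e.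

(* Main.v *)
Require Import Defs.
From mathcomp Require Import all_boot all_order all_algebra.
From mathcomp Require Import all_classical all_reals all_analysis.
From mathcomp Require Import ring lra.
Import Order.TTheory GRing.Theory Num.Theory.
Set Implicit Arguments. Unset Strict Implicit. Unset Printing Implicit Defensive.
Local Open Scope ring_scope.

(* Write [b] for the integer part of [B / cmin]; every feasible decision selects at
   most [b] clients per server, so a round costs at most [b].

   A round that selects an under-explored client increments a counter whose value is
   at most [K T]; there are [N M h^2] counters, so this happens at most
   [N M h^2 (K T + 1)] times.

   In any other round the decision maximises the estimated utility, and its regret is
   at most [2 b] times the largest estimation error among explored pairs.  The bias
   of an estimate is at most the oscillation of [p] on a square.  Its noise exceeds
   [t^(- z / 2)] with probability at most [2 / t^2], by a Chernoff bound on the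
   exponential supermartingale of the observed indicators.  In round 1 no pair is
   explored, so these probabilities are summed only over [t >= 2], which gives at
   most [4 / 3 <= pi^2 / 3]. *)

(** * Hoeffding's lemma for Bernoulli variables, and sums of powers *)

Lemma ge0_derive_ge (R : realType) (f df : R -> R) :
  (forall x : R, is_derive x 1 f (df x)) -> (forall x, 0 <= x -> 0 <= df x) ->
  forall x, 0 <= x -> f 0 <= f x.
Proof.
move=> fdf df0 x x0.
have [|c] := @MVT_segment R f df 0 x x0 (fun y _ => fdf y).
  apply: derivable_within_continuous => y _.
  by case: (fdf y).
rewrite in_itv /= => /andP[c0 _] h.
by rewrite -subr_ge0 h subr0 mulr_ge0 ?df0.
Qed.

(** With [D] the Bernoulli moment generating function, the claim is [f x >= 0] for
    [f y = y^2 / 8 + p y - ln (D y)]. Both [f] and its derivative [g] vanish at 0, and the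
    derivative of [g] is nonnegative, so two integrations from 0 suffice. *)
Lemma hoeffding_bernoulli_ge0 (R : realType) (p x : R) : 0 <= p <= 1 -> 0 <= x ->
  p * expR (x * (1 - p)) + (1 - p) * expR (x * (0 - p)) <= expR (x ^+ 2 / 8).
Proof.
move=> /andP[p0 p1] x0.
pose D (y : R) : R := 1 - p + p * expR y.
have D_gt0 y : 0 < D y.
  by have := expR_gt0 y; rewrite /D; move: (expR y) => e; nra.
have dD (y : R) : is_derive y 1 D (p * expR y).
  rewrite /D; apply: is_derive_eq; rewrite ?scaler0 ?add0r ?addr0 /GRing.scale /=; ring.
pose g (y : R) := y / 4 + p - 1 + (1 - p) * (D y)^-1.
have dg (y : R) : is_derive y 1 g (4^-1 - (1 - p) * (p * expR y) / D y ^+ 2).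
  have D0 : D y != 0 by rewrite gt_eqF.
  have dV := is_deriveV D0 (dD y).
  rewrite /g; apply: is_derive_eq; rewrite ?scaler0 ?add0r ?addr0 /GRing.scale /=.
  by field.
have g_ge0 y : 0 <= y -> 0 <= g y.
  move=> y0; have <- : g 0 = 0 by rewrite /g /D expR0; field; lra.
  apply: (ge0_derive_ge dg) => // u _.
  (* AM-GM for the two summands [1 - p] and [p * expR u] of [D u]. *)
  rewrite subr_ge0 ler_pdivrMr ?exprn_gt0 //.
  by rewrite /D; move: (expR u) => e; have := sqr_ge0 (1 - p - p * e); lra.
pose f (y : R) := y ^+ 2 / 8 + p * y - ln (D y).
have df (y : R) : is_derive y 1 f (g y).
  have dl : is_derive y 1 (fun y => ln (D y)) ((D y)^-1 * (p * expR y)).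
    apply: (@is_derive1_comp _ (@ln R) D); exact: is_derive1_ln.
  rewrite /f; apply: is_derive_eq; rewrite ?scaler0 ?add0r ?addr0 /GRing.scale /=.
  have := D_gt0 y; rewrite /g /D => H; field; lra.
have f_ge0 : 0 <= f x.
  have <- : f 0 = 0 by rewrite /f /D expR0 mulr1 subrK ln1; ring.
  exact: (ge0_derive_ge df).
have -> : p * expR (x * (1 - p)) + (1 - p) * expR (x * (0 - p)) = expR (- (p * x)) *
  D x.
  have -> : x * (1 - p) = - (p * x) + x by ring.
  have -> : x * (0 - p) = - (p * x) by ring.
  rewrite expRD /D; ring.
have -> : D x = expR (ln (D x)) by rewrite lnK // posrE.
rewrite -expRD ler_expR; move: f_ge0; rewrite /f; lra.
Qed.

(** A negative [x] reduces to the previous case by passing to the complementary variable, that is,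
    replacing [(p, x)] by [(1 - p, - x)]. *)
Lemma hoeffding_bernoulli (R : realType) (p x : R) : 0 <= p <= 1 ->
  p * expR (x * (1 - p)) + (1 - p) * expR (x * (0 - p)) <= expR (x ^+ 2 / 8).
Proof.
move=> p01; have [x0|x0] := leP 0 x; first exact: hoeffding_bernoulli_ge0.
have H := @hoeffding_bernoulli_ge0 R (1 - p) (- x).
have : 0 <= 1 - p <= 1 by lra.
have /[swap] /H /[apply] : 0 <= - x by lra.
rewrite sqrrN; apply: le_trans.
have -> : 1 - (1 - p) = p by ring.
have -> : - x * p = x * (0 - p) by ring.
have -> : - x * (0 - (1 - p)) = x * (1 - p) by ring.
by rewrite addrC.
Qed.

(** Young's inequality for [powR u e] and 1, with conjugate exponents [1 / e] and [1 / (1 - e)]. *)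
Lemma powR_le_tangent1 (R : realType) (u e : R) : 0 <= u -> 0 < e < 1 ->
  powR u e <= 1 + e * (u - 1).
Proof.
move=> u0 /andP[e0 e1].
have := @conjugate_powR R (powR u e) 1 e^-1 (1 - e)^-1 (powR_ge0 _ _) ler01.
rewrite !invrK mulr1 -powRrM mulfV ?gt_eqF // powRr1 // powR1.
rewrite !invr_gt0 e0 subr_gt0 e1 => /(_ isT isT).
have -> : e + (1 - e) = 1 by ring.
move=> /(_ erefl); lra.
Qed.

(** A discrete comparison with the integral of [x^(- a)]: the induction step is the tangent
    inequality at [u = 1 - 1 / t], multiplied by [t^(1 - a)]. *)
Lemma sum_powRN_le (R : realType) (T : nat) (a : R) : 0 < a < 1 ->
  \sum_(i < T) powR i.+1%:R (- a) <= powR T%:R (1 - a) / (1 - a).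
Proof.
move=> /andP[a0 a1]; have e0 : 0 < 1 - a by lra.
elim: T => [|T IH].
  by rewrite big_ord0 divr_ge0 ?powR_ge0 // ltW.
rewrite big_ord_recr /=; apply: le_trans (lerD IH (lexx _)) _.
rewrite -lerBrDl -mulrBl ler_pdivlMr //.
set t : R := T.+1%:R; have t0 : 0 < t by rewrite ltr0n.
have -> : T%:R = t * (1 - t^-1) :> R.
  by rewrite mulrBr mulfV ?gt_eqF // mulr1 /t -natr1 addrK.
have u0 : 0 <= 1 - t^-1 by rewrite subr_ge0 invf_le1 // ler1n.
rewrite powRM ?(ltW t0) //.
have -> : powR t (- a) = powR t (1 - a) * t^-1.
  by rewrite -[t^-1]powR_inv1 ?(ltW t0) // -powRD ?(gt_eqF t0) ?implybT //;
    congr powR; ring.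
have /(powR_le_tangent1 u0) : 0 < 1 - a < 1 by lra.
rewrite -subr_ge0 => /(mulr_ge0 (powR_ge0 t (1 - a)));
  move: (powR (1 - t^-1) (1 - a)) (powR t (1 - a)) (t^-1) => x y v; lra.
Qed.

Lemma sum_inv_sqr_le (R : realType) (T : nat) :
  \sum_(i < T | (0 < i)%N) (i.+1%:R ^- 2 : R) <= 2 / 3.
Proof.
(* The strengthened bound telescopes, since [(n + 2)^(-2)] is below [1 / (n + 3/2) - 1 / (n + 5/2) =
   1 / ((n + 2)^2 - 1/4)]. The constant [2 / 3] makes it 0 at [n = 0]. *)
suff H : forall n, \sum_(i < n.+1 | (0 < i)%N) (i.+1%:R ^- 2 : R)
  <= 2 / 3 - (n%:R + 3 / 2)^-1.
  case: T => [|n]; first by rewrite big_ord0 divr_ge0.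
  apply: le_trans (H n) _; rewrite gerBl invr_ge0; have := ler0n R n; lra.
elim=> [|n IH].
  by rewrite big_mkcond big_ord1 /= add0r invf_div subrr.
rewrite big_mkcond big_ord_recr -big_mkcond /=.
apply: le_trans (lerD IH (lexx _)) _.
rewrite -(natr1 n.+1) -(natr1 n); set x : R := n%:R; have x0 : 0 <= x by exact: ler0n.
rewrite -subr_ge0.
have -> : 2 / 3 - (x + 1 + 3 / 2)^-1 - (2 / 3 - (x + 3 / 2)^-1 + (x + 1 + 1) ^- 2)
  = (4^-1) / ((x + 1 + 3 / 2) * (x + 3 / 2) * (x + 1 + 1) ^+ 2).
  by field; rewrite ?lt0r_neq0; nra.
by apply: divr_ge0 => //; do !apply: mulr_ge0; lra.
Qed.

(** * Expectation under the finite product of Bernoulli laws *)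

Section Expectation.
Variables (R : realType) (T N M : nat).
Variables (p : 'I_N -> 'I_M -> R * R -> R) (ctx : nat -> 'I_N -> 'I_M -> R * R).

Local Notation outcome := (outcome T N M).
Local Notation E := (@expect R T N M p ctx).

Definition mean (j : 'I_T) (x : 'I_N * 'I_M) : R := p x.1 x.2 (ctx j.+1 x.1 x.2).

(** Overwriting one indicator allows it to be averaged out of the product law; this plays the part
    of a conditional expectation. *)
Definition upd (w : outcome) (i : 'I_T) (x : 'I_N * 'I_M) (b : bool) : outcome :=
  [ffun j => [ffun y => if (j == i) && (y == x) then b else w j y]].

Lemma updE (w : outcome) i x b j y :
  upd w i x b j y = if (j == i) && (y == x) then b else w j y.
Proof. by rewrite !ffunE. Qed.

Lemma upd_id (w : outcome) i x b : w i x = b -> upd w i x b = w.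
Proof.
by move=> wb; apply/ffunP => j; apply/ffunP => y; rewrite updE;
  case: andP => // -[/eqP-> /eqP->].
Qed.

Lemma upd_upd w i x b b' : upd (upd w i x b) i x b' = upd w i x b'.
Proof. by apply/ffunP => j; apply/ffunP => y; rewrite !updE; case: andP. Qed.

Lemma sum_upd (F : outcome -> R) i x :
  \sum_w F w = \sum_(w : outcome | w i x) (F w + F (upd w i x false)).
Proof.
rewrite (bigID (fun w : outcome => w i x)) big_split /=; congr (_ + _).
rewrite (reindex_onto (fun w => upd w i x false) (fun w => upd w i x true)) /=;
  last first.
  by move=> w /negbTE wi; rewrite upd_upd upd_id.
apply: eq_bigl => w; rewrite updE !eqxx upd_upd /=.
apply/eqP/idP => [<-|/upd_id //]; by rewrite updE !eqxx.
Qed.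

(** [sum_upd] groups the outcomes into pairs that differ only at [(i, x)]. Within a pair the
    remaining factors of [prob] agree, and the two weights at [(i, x)] add up to 1. *)
Lemma expect_upd (F : outcome -> R) i x :
  E F = E (fun w => mean i x * F (upd w i x true)
                    + (1 - mean i x) * F (upd w i x false)).
Proof.
pose co (w : outcome) jx : R :=
  if w jx.1 jx.2 then mean jx.1 jx.2 else 1 - mean jx.1 jx.2.
pose rest (w : outcome) : R := \prod_(jx | jx != (i, x)) co w jx.
have probE w : prob p ctx w = co w (i, x) * rest w.
  by rewrite /prob pair_bigA /= (bigD1 (i, x)).
have rest_upd w b : rest (upd w i x b) = rest w.
  apply: eq_bigr => -[j y] ne; rewrite /co /= updE; case: andP => // -[/eqP ji /eqP yx].
  by rewrite ji yx eqxx in ne.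
rewrite /expect (sum_upd _ i x) [RHS](sum_upd _ i x); apply: eq_bigr => w wix.
rewrite !probE !rest_upd !upd_upd (upd_id wix) /co /= wix updE !eqxx /=; ring.
Qed.

Lemma sum_prob : \sum_(w : outcome) prob p ctx w = 1.
Proof.
pose co j x (b : bool) : R := if b then mean j x else 1 - mean j x.
transitivity (\prod_(j < T) \sum_(f : {ffun 'I_N * 'I_M -> bool}) \prod_x co j x (f x)).
  by rewrite bigA_distr_bigA.
apply: big1 => j _; rewrite -(bigA_distr_bigA (co j)).
by apply: big1 => x _; rewrite big_bool /co /= subrKC.
Qed.

Lemma expect_cst (a : R) : E (fun=> a) = a.
Proof. by rewrite /expect -mulr_suml sum_prob mul1r. Qed.

Lemma expectZ (a : R) F : E (fun w => a * F w) = a * E F.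
Proof. by rewrite /expect mulr_sumr; apply: eq_bigr => w _; rewrite mulrCA. Qed.

Lemma expectD F G : E (fun w => F w + G w) = E F + E G.
Proof. by rewrite /expect -big_split; apply: eq_bigr => w _; rewrite mulrDr. Qed.

Lemma expect_sum (I : finType) (P : pred I) F :
  E (fun w => \sum_(i | P i) F i w) = \sum_(i | P i) E (F i).
Proof. by rewrite /expect exchange_big; apply: eq_bigr => w _; rewrite mulr_sumr. Qed.

Lemma eq_expect F G : F =1 G -> E F = E G.
Proof. by move=> FG; apply: eq_bigr => w _; rewrite FG. Qed.

Hypothesis mean01 : forall j x, 0 <= mean j x <= 1.

Lemma le_expect F G : (forall w, F w <= G w) -> E F <= E G.
Proof.
move=> FG; apply: ler_sum => w _; apply: ler_wpM2l => //.
apply: prodr_ge0 => j _; apply: prodr_ge0 => x _.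
by have /andP[? ?] := mean01 j x; case: (w j x); rewrite // subr_ge0.
Qed.

(** A tower property: neither the past [U] nor the gate [G] sees the indicator at [(i, x)], which
    can therefore be averaged first. *)
Lemma expect_gated (U : outcome -> R) (G : outcome -> bool) (g : bool -> R) i x :
  (forall w b, U (upd w i x b) = U w) -> (forall w b, G (upd w i x b) = G w) ->
  E (fun w => U w * (if G w then g (w i x) else 1)) =
  E (fun w => U w * (if G w then mean i x * g true + (1 - mean i x) * g false else 1)).
Proof.
move=> Uu Gu; rewrite (expect_upd _ i x); apply: eq_expect => w.
rewrite !Uu !Gu !updE !eqxx /=; case: (G w); ring.
Qed.

End Expectation.

(** * Concentration of the observed indicators *)

Section Deviation.
Variables (R : realType) (T N M : nat).
Variables (p : 'I_N -> 'I_M -> R * R -> R) (ctx : nat -> 'I_N -> 'I_M -> R * R).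
Variable sel : 'I_T -> outcome T N M -> decision N M.
Variable h : nat.

Local Notation outcome := (outcome T N M).
Local Notation E := (@expect R T N M p ctx).

Hypothesis mean01 : forall (j : 'I_T) x, 0 <= mean p ctx j x <= 1.
Hypothesis sel_nonanticipating : forall (i : 'I_T) (w w' : outcome),
  (forall j : 'I_T, (j < i)%N -> forall n m, n \in sel j w m ->
     w j (n, m) = w' j (n, m)) -> sel i w = sel i w'.

(** The case [i = k] matters: a decision does not see the indicators of its own round. *)
Lemma sel_upd (i k : 'I_T) (w : outcome) x b : (i <= k)%N ->
  sel i (upd w k x b) = sel i w.
Proof.
move=> ik; apply: sel_nonanticipating => j ji n m _; rewrite updE.
by case: eqP => // jk; rewrite -jk leqNgt ji in ik.
Qed.

(** The decision of round [i] is unaffected by the indicators of that round, so each of them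
    averages to its mean even though the decision is random. *)
Lemma expect_utility_sel (i : 'I_T) :
  E (fun w => utility (sel i w) (Xobs R w i)) =
  E (fun w => utility (sel i w) (fun n m => mean p ctx i (n, m))).
Proof.
rewrite !expectZ !expect_sum; congr (_ * _); apply: eq_bigr => m _.
under eq_expect do rewrite big_mkcond.
under [RHS]eq_expect do rewrite big_mkcond.
rewrite !expect_sum; apply: eq_bigr => n _.
rewrite (expect_upd _ _ _ i (n, m)); apply: eq_expect => w.
rewrite !sel_upd // /Xobs !updE !eqxx /=; case: ifP => _; ring.
Qed.

Lemma expect_utility_cst (s : decision N M) (i : 'I_T) :
  E (fun w => utility s (Xobs R w i)) = utility s (fun n m => mean p ctx i (n, m)).
Proof.
rewrite !expectZ !expect_sum; congr (_ * _); apply: eq_bigr => m _.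
rewrite !expect_sum; apply: eq_bigr => n _.
rewrite (expect_upd _ _ _ i (n, m)) -[RHS](expect_cst T p ctx); apply: eq_expect => w.
rewrite /Xobs !updE !eqxx /=; ring.
Qed.

Variables (n : 'I_N) (m : 'I_M) (l : nat * nat).

Definition observed (w : outcome) (j : 'I_T) : bool :=
  (n \in sel j w m) && (cell h (ctx j.+1 n m) == l).

Definition dev_sum (w : outcome) (i : 'I_T) : R :=
  \sum_(j < T | (j < i)%N && observed w j) ((w j (n, m))%:R - mean p ctx j (n, m)).

(** The compensator [a ^+ 2 / 8] is the one of Hoeffding's lemma, so that each factor has
    conditional mean at most 1; rounds without observation contribute 1. *)
Definition exp_mart (a : R) (k : nat) (w : outcome) : R :=
  \prod_(j < T | (j < k)%N)
    (if observed w j then expR (a * ((w j (n, m))%:R - mean p ctx j (n,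
      m)) - a ^+ 2 / 8)
     else 1).

Lemma exp_martE a (i : 'I_T) w :
  exp_mart a i w = expR (a * dev_sum w i - a ^+ 2 / 8 * (counter sel ctx h w i n m
    l)%:R).
Proof.
rewrite /exp_mart -big_mkcondr -expR_sum big_split /= -mulr_sumr; congr expR.
rewrite sumr_const mulNrn mulr_natr /counter cardsE /dev_sum; congr (_ - _ *+ _).
Qed.

Lemma exp_mart_ge0 a k w : 0 <= exp_mart a k w.
Proof. by apply: prodr_ge0 => j _; case: ifP => // _; exact: expR_ge0. Qed.

Lemma expect_exp_mart_le1 a k : (k <= T)%N -> E (exp_mart a k) <= 1.
Proof.
elim: k => [_|k IH kT].
  rewrite -[leRHS](expect_cst T p ctx) le_eqVlt; apply/orP; left; apply/eqP.
  by apply: eq_expect => w; rewrite /exp_mart big1.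
apply: le_trans (IH (ltnW kT)); pose i := Ordinal kT.
pose g (b : bool) := expR (a * ((b : nat)%:R - mean p ctx i (n, m)) - a ^+ 2 / 8).
(* Round [k] is split off: the earlier factors and the event of being observed depend only on
   earlier indicators, as [expect_gated] requires. *)
have -> : E (exp_mart a k.+1) = E (fun w =>
  exp_mart a k w * (if observed w i then g (w i (n, m)) else 1)).
  apply: eq_expect => w; rewrite /exp_mart (bigD1 i) //= mulrC; congr (_ * _).
  by apply: eq_bigl => j; rewrite ltnS -val_eqE /= andbC -ltn_neqAle.
rewrite expect_gated.
- apply: le_expect => // w; rewrite -[leRHS]mulr1 ler_wpM2l ?exp_mart_ge0 //.
  case: ifP => // _;
    rewrite /g !expRD !mulrA -mulrDl expRN ler_pdivrMr ?expR_gt0 // mul1r.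
  exact: hoeffding_bernoulli.
- move=> w b; apply: eq_bigr => j jk; rewrite /observed sel_upd ?(ltnW jk) // updE.
  by rewrite -val_eqE /= (ltn_eqF jk).
- by move=> w b; rewrite /observed sel_upd.
Qed.

(* On the event, the exponential martingale at [4 d] (or [- 4 d]) is at least
   [expR (2 d^2 C) >= expR (2 d^2 k)] whatever the random counter [C] is, so no union
   bound over the values of [C] is needed. *)
Lemma expect_deviation_le (k d : R) (i : 'I_T) : 0 <= d ->
  E (fun w => ((k < (counter sel ctx h w i n m l)%:R) &&
               (d * (counter sel ctx h w i n m l)%:R <= `|dev_sum w i|))%:R)
  <= 2 * expR (- (2 * d ^+ 2 * k)).
Proof.
(* The parameter [4 d] maximises [a d - a^2 / 8], with value [2 d^2]; the two signs serve the two
   tails. *)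
move=> d0; pose F w := expR (- (2 * d ^+ 2 * k)) *
  (exp_mart (4 * d) i w + exp_mart (- (4 * d)) i w).
have H : E F <= 2 * expR (- (2 * d ^+ 2 * k)).
  rewrite expectZ expectD mulrC ler_wpM2r ?expR_ge0 //.
  by apply: (@lerD _ _ 1 _ 1); apply: expect_exp_mart_le1; exact: ltnW.
apply: le_trans H; apply: le_expect => // w; rewrite /F.
case: andP => [[kC dC]|_]; last first.
  by rewrite mulr_ge0 ?expR_ge0 ?addr_ge0 ?exp_mart_ge0.
rewrite /= expRN mulrC ler_pdivlMr ?expR_gt0 // mul1r.
set C : R := _%:R in kC dC.
have le_sq : 2 * d ^+ 2 * k <= 2 * d ^+ 2 * C
  by rewrite ler_wpM2l ?mulr_ge0 ?sqr_ge0 // ltW.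
have dC' : 4 * d * (d * C) <= 4 * d * `|dev_sum w i| by rewrite ler_wpM2l // mulr_ge0.
have [S0|S0] := leP 0 (dev_sum w i).
- apply: le_trans (_ : exp_mart (4 * d) i w <= _); last by rewrite lerDl exp_mart_ge0.
  by rewrite exp_martE ler_expR -/C; rewrite ger0_norm // in dC'; lra.
- apply: le_trans (_ : exp_mart (- (4 * d)) i w <= _);
    last by rewrite lerDr exp_mart_ge0.
  by rewrite exp_martE ler_expR -/C; rewrite ltr0_norm // in dC'; lra.
Qed.

End Deviation.

(** * Diameter of the squares of the partition *)

Lemma slot_bounds (R : realType) (h : nat) (a : R) : (0 < h)%N -> 0 <= a <= 1 ->
  (minn (Num.truncn (a * h%:R)) h.-1)%:R <= a * h%:R
    <= (minn (Num.truncn (a * h%:R)) h.-1)%:R + 1.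
Proof.
move=> h0 /andP[a0 a1]; have ah0 : 0 <= a * h%:R by rewrite mulr_ge0.
have /andP[tl tu] := truncn_itv ah0; apply/andP; split.
  by apply: le_trans tl; rewrite ler_nat geq_minl.
(* When the cap [h - 1] is active, the upper bound comes from [a <= 1]. *)
case: leqP => _.
  by rewrite natr1 ltW.
by rewrite natr1 prednK // ler_piMl.
Qed.

(** Each coordinate differs by at most [1 / h], so the distance is at most the diagonal
    [sqrt 2 / h]. *)
Lemma dist2_cell_le (R : realType) (h : nat) (alpha : R) (u v : R * R) :
  (0 < h)%N -> 0 < alpha -> in_Phi u -> in_Phi v -> cell h u = cell h v ->
  powR (dist2 u v) alpha <= powR 2 (alpha / 2) * powR h%:R (- alpha).
Proof.
move=> h0 al0 [u1 u2] [v1 v2] [e1 e2].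
have hR : 0 < h%:R :> R by rewrite ltr0n.
have close (a b : R) : 0 <= a <= 1 -> 0 <= b <= 1 ->
    minn (Num.truncn (a * h%:R)) h.-1 = minn (Num.truncn (b * h%:R)) h.-1 ->
    (a - b) ^+ 2 <= h%:R ^- 2.
  move=> /(slot_bounds h0) + /(slot_bounds h0) + e; rewrite e => /andP[? ?] /andP[? ?].
  rewrite -exprVn -real_normK ?num_real // lerXn2r ?nnegrE ?invr_ge0 ?(ltW hR) //.
  rewrite -[leRHS]mul1r ler_pdivlMr // -(ger0_norm (ltW hR)) -normrM ler_norml; lra.
have s0 : 0 <= (u.1 - v.1) ^+ 2 + (u.2 - v.2) ^+ 2 by rewrite addr_ge0 ?sqr_ge0.
rewrite /dist2 -powR12_sqrt //. rewrite -powRrM.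
have -> : powR 2 (alpha / 2) * powR h%:R (- alpha) = powR (2 * h%:R ^- 2) (2^-1 *
  alpha).
  rewrite powRM ?invr_ge0 ?exprn_ge0 ?(ltW hR) // [2^-1 * _]mulrC; congr (_ * _).
  rewrite -powR_invn ?(ltW hR) // -powRrM; congr powR; by field.
apply: (ge0_ler_powR (r := 2^-1 * alpha));
  rewrite ?nnegrE ?mulr_ge0 ?invr_ge0 ?exprn_ge0 ?(ltW hR) ?(ltW al0) //.
by have := close _ _ u1 v1 e1; have := close _ _ u2 v2 e2; lra.
Qed.

(** * Elementary bounds on the utility *)

Section Utility.
Variables (R : realType) (N M : nat).
Implicit Types (s : decision N M) (x y : 'I_N -> 'I_M -> R).

Lemma utilityB s x y : utility s x - utility s y = utility s (fun n m => x n m - y n m).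
Proof.
rewrite /utility -mulrBr -sumrB; congr (_ * _); apply: eq_bigr => m _.
by rewrite -sumrB.
Qed.

Lemma eq_utility s x y : (forall m n, n \in s m -> x n m = y n m) ->
  utility s x = utility s y.
Proof.
by move=> xy; congr (_ * _); apply: eq_bigr => m _; apply: eq_bigr => n; exact: xy.
Qed.

Lemma utility_ge0 s x : (forall n m, 0 <= x n m) -> 0 <= utility s x.
Proof.
by move=> x0; apply: mulr_ge0; rewrite ?invr_ge0 //; do !apply: sumr_ge0 => ? _.
Qed.

(** The factor [1 / M] cancels the sum over the servers, so only the bound [b] per server
    remains. *)
Lemma utility_le s x (b : nat) (c : R) : (0 < M)%N -> 0 <= c ->
  (forall m, (#|s m| <= b)%N) -> (forall m n, n \in s m -> x n m <= c) ->
  utility s x <= c * b%:R.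
Proof.
move=> M0 c0 sb xc; rewrite /utility mulrC ler_pdivrMr ?ltr0n //.
have -> : c * b%:R * M%:R = \sum_(m < M) c * b%:R
  by rewrite sumr_const card_ord mulr_natr.
apply: ler_sum => m _; apply: le_trans (_ : \sum_(n in s m) c <= _).
  by apply: ler_sum => n; exact: xc.
by rewrite sumr_const -[leLHS]mulr_natr ler_wpM2l // ler_nat.
Qed.

Lemma feasible_card (Nset : 'I_M -> {set 'I_N}) (cost : 'I_N -> R) (B cmin : R) s m :
  0 < cmin -> (forall n, cmin <= cost n) -> feasible Nset cost B s ->
  (#|s m| <= Num.truncn (B / cmin))%N.
Proof.
move=> c0 cmin_le [_ [sB _]].
have H : #|s m|%:R * cmin <= B.
  by apply: le_trans (sB m); rewrite mulr_natl -sumr_const; exact: ler_sum.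
have : #|s m|%:R <= B / cmin by rewrite ler_pdivlMr.
move=> H'; rewrite truncn_ge_nat //; exact: le_trans H'.
Qed.

End Utility.

(** * Number of exploration rounds, and regret of a single round *)

Section Rounds.
Variables (R : realType) (T N M : nat).
Variables (p : 'I_N -> 'I_M -> R * R -> R) (ctx : nat -> 'I_N -> 'I_M -> R * R).
Variable sel : 'I_T -> outcome T N M -> decision N M.
Variables (h : nat) (Nset : nat -> 'I_M -> {set 'I_N}) (K : nat -> R).
Variables (cost : nat -> 'I_N -> R) (B : R).

Local Notation n_under_sel w i := (n_under sel ctx h Nset K w i (sel i w)).
Local Notation cell_at i n m := (cell h (ctx i.+1 n m)).
Local Notation count w i n m := (counter sel ctx h w i n m (cell_at i n m)).

(** Each counted round is charged to a selected under-explored pair and its square. For a fixed pair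
    and square the counter increases strictly along the charged rounds and stays at most [k], hence
    takes each value [0, ..., floor k] at most once. *)
Lemma exploration_rounds_le (w : outcome T N M) (k : R) : (0 < h)%N -> 0 <= k ->
  (forall i : 'I_T, K i.+1 <= k) ->
  \sum_(i < T) ((0 < n_under_sel w i)%N)%:R <= N%:R * M%:R * h%:R ^+ 2 * (k + 1).
Proof.
move=> h0 k0 Kk.
have cell_ltn (u : R * R) : ((cell h u).1 < h)%N && ((cell h u).2 < h)%N.
  by apply/andP; split; apply: leq_ltn_trans (geq_minr _ _) _; rewrite ltn_predL.
pose A (x : 'I_N * 'I_M) (l : 'I_h * 'I_h) := [set i : 'I_T |
  [&& x.1 \in sel i w x.2, cell_at i x.1 x.2 == (val l.1, val l.2) &
      (count w i x.1 x.2)%:R <= k]].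
have cardA x l : #|A x l|%:R <= k + 1.
  pose f (i : 'I_T) : 'I_(Num.truncn k).+1 :=
    inord (counter sel ctx h w i x.1 x.2 (val l.1, val l.2)).
  have f_lt (i j : 'I_T) : (i < j)%N -> i \in A x l -> j \in A x l -> f i != f j.
    rewrite !inE => ij /and3P[si ci ki] /and3P[_ cj kj].
    rewrite -val_eqE /= !inordK; last 2 first.
    - by rewrite ltnS truncn_ge_nat // -(eqP cj).
    - by rewrite ltnS truncn_ge_nat // -(eqP ci).
    (* Every round counted before [i] is counted before [j] as well, and [i] itself is counted only
       at [j]. *)
    rewrite ltn_eqF //; apply: proper_card; apply/properP; split.
      apply/fintype.subsetP => a; rewrite !inE => /and3P[ai -> ->].
      by rewrite (ltn_trans ai ij).
    by exists i; rewrite !inE ?ltnn // ij si ci.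
  have f_inj : {in A x l &, injective f}.
    move=> i j iA jA; apply: contra_eq => ij; move: (ij); rewrite -val_eqE neq_ltn.
    by case/orP => [/f_lt -> //|/f_lt H]; rewrite eq_sym H.
  have : (#|A x l| <= (Num.truncn k).+1)%N.
    by rewrite -(card_in_imset f_inj) -[X in (_ <= X)%N]card_ord max_card.
  rewrite -(ler_nat R) => /le_trans; apply; rewrite -natr1 lerD2r.
  by have /andP[] := truncn_itv k0.
apply: le_trans (_ : \sum_(i < T) \sum_x \sum_(l : 'I_h * 'I_h) ((i \in A x l) :
  nat)%:R <= _).
  apply: ler_sum => i _; case: (posnP (n_under_sel w i)) => [_|].
    by do !apply: sumr_ge0 => ? _.
  rewrite card_gt0 => /set0Pn[x]; rewrite inE => /andP[xs /andP[_ xK]].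
  have /andP[l1 l2] := cell_ltn (ctx i.+1 x.1 x.2).
  rewrite (bigD1 x) //= (bigD1 (Ordinal l1, Ordinal l2)) //= inE xs eqxx.
  rewrite (le_trans xK) // -addrA lerDl addr_ge0 //; by do !apply: sumr_ge0 => ? _.
rewrite exchange_big; under eq_bigr do rewrite exchange_big.
apply: le_trans (_ : \sum_(x : 'I_N * 'I_M) \sum_(l : 'I_h * 'I_h) (k + 1) <= _).
  apply: ler_sum => x _; apply: ler_sum => l _.
  by apply: le_trans (cardA x l); rewrite -natr_sum ler_nat -big_mkcond sum1_card.
rewrite !sumr_const !card_prod !card_ord -mulrnA -[leLHS]mulr_natr !natrM le_eqVlt.
by apply/orP; left; apply/eqP; ring.
Qed.

Hypothesis policy : cocs_policy sel ctx h Nset K cost B.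

Lemma sel_feasible (i : 'I_T) w : feasible (Nset i.+1) (cost i.+1) B (sel i w).
Proof. by case: (policy.2 i w). Qed.

(** In an exploration round the chosen decision maximises the number of under-explored clients; if
    that maximum is 0, no feasible decision contains one. In an exploitation round there are none at
    all. *)
Lemma explored_members (i : 'I_T) w s : n_under_sel w i = 0%N ->
  feasible (Nset i.+1) (cost i.+1) B s ->
  forall m n, n \in s m -> ~~ under_explored sel ctx h Nset K w i n m.
Proof.
move=> u0 fs m n ns; have [_] := policy.2 i w; case: ifP => [_ [maxu _]|/negbT noU _].
  have := maxu s fs; rewrite u0 leqn0 cards_eq0 => /eqP/setP/(_ (n, m)).
  by rewrite !inE /= ns /= => ->.
by apply: contra noU => un; apply/existsP; exists (n, m).
Qed.

(* An exploration round that selects no under-explored client is in effect an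
   exploitation round: this happens when the under-explored ones are unaffordable. *)
Lemma sel_optimal_estimate (i : 'I_T) w s : n_under_sel w i = 0%N ->
  feasible (Nset i.+1) (cost i.+1) B s ->
  utility s (Xhat sel ctx h w i) <= utility (sel i w) (Xhat sel ctx h w i).
Proof.
move=> u0 fs; have := policy.2 i w; move=> [fsel]; case: ifP => [_ [_ opt]|_ opt];
  last exact: opt.
have masked s' : feasible (Nset i.+1) (cost i.+1) B s' ->
    utility s' (Xhat sel ctx h w i) = utility s' (fun n m =>
      if under_explored sel ctx h Nset K w i n m then 0 else Xhat sel ctx h w i n m).
  by move=> fs'; apply: eq_utility => m n ns;
    rewrite (negbTE (explored_members u0 fs' ns)).
(* Both sets of selected under-explored clients are empty, so [s] competes in the secondary
   maximisation. *)
rewrite !masked //; apply: opt => // m; apply/setP => n; rewrite !inE.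
case ns: (n \in s m); rewrite ?(negbTE (explored_members u0 fs ns));
by case ns': (n \in sel i w m); rewrite ?(negbTE (explored_members u0 fsel ns')).
Qed.

(** The noise inequality is multiplied through by the counter, in the form bounded by
    [expect_deviation_le]. *)
Definition deviates (d : R) (i : 'I_T) n m (w : outcome T N M) : bool :=
  (K i.+1 < (count w i n m)%:R) &&
  (d * (count w i n m)%:R <= `|dev_sum p ctx sel h n m (cell_at i n m) w i|).

Variable beta : R.
Hypothesis K_ge0 : forall i : 'I_T, 0 <= K i.+1.
Hypothesis bias : forall (i j : 'I_T) n m, cell_at j n m = cell_at i n m ->
  `|mean p ctx j (n, m) - mean p ctx i (n, m)| <= beta.

(** The error times the counter [C] is [S + D]. The noise [S] is at most [d C] off the deviation
    event; the bias [D] sums [C] differences of means between contexts in one square, each at most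
    [beta]. *)
Lemma estimate_error (d : R) (i : 'I_T) n m w :
  K i.+1 < (count w i n m)%:R -> ~~ deviates d i n m w ->
  `|Xhat sel ctx h w i n m - mean p ctx i (n, m)| <= d + beta.
Proof.
move=> KC; rewrite /deviates KC /= -ltNge => /ltW.
have C0 : 0 < (count w i n m)%:R :> R by exact: le_lt_trans (K_ge0 i) KC.
rewrite /Xhat /estimate; set C := _%:R in C0 *;
  set S := dev_sum _ _ _ _ _ _ _ _ _ => SC.
pose P (j : 'I_T) := [&& (j < i)%N, n \in sel j w m & cell_at j n m == cell_at i n m].
have CE (a : R) : \sum_(j | P j) a = a * C.
  by rewrite sumr_const -mulr_natr /C /counter cardsE.
pose D := \sum_(j | P j) (mean p ctx j (n, m) - mean p ctx i (n, m)).
have -> : (\sum_(j | P j) (w j (n, m) : nat)%:R) / C - mean p ctx i (n,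
  m) = (S + D) / C.
  have -> : S + D = \sum_(j | P j) ((w j (n, m) : nat)%:R - mean p ctx i (n, m)).
    by rewrite -big_split; apply: eq_bigr => j _ /=; ring.
  by rewrite sumrB CE mulrBl mulfK // gt_eqF.
rewrite normrM normfV (gtr0_norm C0) ler_pdivrMr // mulrDl.
apply: le_trans (ler_normD _ _) (lerD SC _).
apply: le_trans (ler_norm_sum _ _ _) _.
rewrite -CE; apply: ler_sum => j /and3P[_ _ /eqP]; exact: bias.
Qed.

(** If an under-explored client is selected or some pair deviates, an indicator on the right is 1
    and the crude bound [b] suffices. Otherwise pass from true to estimated utility of [s], then to
    that of [sel i w] by optimality, then back; each change of utility costs [(d + beta) b]. *)
Lemma round_regret_le (d : R) (b : nat) (i : 'I_T) s w : (0 < M)%N -> 0 <= d -> 0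
  <= beta ->
  (forall n m, 0 <= mean p ctx i (n, m) <= 1) ->
  (forall s, feasible (Nset i.+1) (cost i.+1) B s -> forall m, (#|s m| <= b)%N) ->
  feasible (Nset i.+1) (cost i.+1) B s ->
  utility s (fun n m => mean p ctx i (n, m))
  - utility (sel i w) (fun n m => mean p ctx i (n, m))
  <= b%:R * ((0 < n_under_sel w i)%N%:R
             + \sum_(x : 'I_N * 'I_M) (deviates d i x.1 x.2 w)%:R + 2 * (d + beta)).
Proof.
move=> M0 d0 be0 mean01 card_b fs.
have fsel := sel_feasible i w.
set mu := fun n m => mean p ctx i (n, m).
have dev0 : 0 <= \sum_(x : 'I_N * 'I_M) (deviates d i x.1 x.2 w)%:R :> R
  by exact: sumr_ge0.
have crude : utility s mu - utility (sel i w) mu <= b%:R * 1.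
  rewrite lerBlDr mulrC; apply: le_trans (_ : 1 * b%:R <= _).
    by apply: utility_le => // [m|m n _]; [exact: card_b|case/andP: (mean01 n m)].
  by rewrite lerDl utility_ge0 // => n m; case/andP: (mean01 n m).
case: (posnP (n_under_sel w i)) => [u0|_]; last first.
  by apply: le_trans crude _;
    rewrite ler_wpM2l // -addrA lerDl !addr_ge0 ?mulr_ge0 ?addr_ge0.
have [/existsP[x dx]|/existsPn nodev] :=
  boolP [exists x : 'I_N * 'I_M, deviates d i x.1 x.2 w].
  apply: le_trans crude _; rewrite ler_wpM2l // add0r (bigD1 x) //= dx -addrA lerDl.
  by rewrite addr_ge0 ?sumr_ge0 ?mulr_ge0 ?addr_ge0.
have close s' : feasible (Nset i.+1) (cost i.+1) B s' -> forall m n, n \in s' m ->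
    `|Xhat sel ctx h w i n m - mu n m| <= d + beta.
  move=> fs' m n ns; apply: estimate_error (nodev (n, m)).
  have := explored_members u0 fs' ns; rewrite /under_explored ltNge.
  by rewrite (fintype.subsetP (fs'.1 m) _ ns).
have opt := sel_optimal_estimate u0 fs.
have H1 : utility s mu - utility s (Xhat sel ctx h w i) <= (d + beta) * b%:R.
  rewrite utilityB; apply: utility_le; rewrite ?addr_ge0 //; first exact: card_b.
  by move=> m n /(close _ fs); rewrite distrC => /ler_normlW.
have H2 : utility (sel i w) (Xhat sel ctx h w i) - utility (sel i w) mu
  <= (d + beta) * b%:R.
  rewrite utilityB; apply: utility_le; rewrite ?addr_ge0 //; first exact: card_b.
  by move=> m n /(close _ fsel) /ler_normlW.
have : 0 <= b%:R * \sum_(x : 'I_N * 'I_M) (deviates d i x.1 x.2 w)%:R :> R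
  by exact: mulr_ge0.
rewrite !mulrDr mulr0 add0r; lra.
Qed.

End Rounds.

(** * Arithmetic of the exponents of the policy *)

Section Exponents.
Variables (R : realType) (alpha : R).
Hypothesis alpha_gt0 : 0 < alpha.
Local Notation z := (z_par alpha).
Local Notation gamma := (gamma_par alpha).

(** The identity [gamma * alpha = z / 2] balances the bias [h^(- alpha)] against the noise
    threshold; [gamma * 2] is the exponent of [h^2], and [1 - z / 2] that of the accumulated
    errors. *)
Lemma exponent_relations :
  [/\ 0 < z / 2 < 1, gamma * 2 = 2 / (3 * alpha + 2), gamma * alpha = z / 2,
      0 <= gamma & 1 - z / 2 = (2 * alpha + 2) / (3 * alpha + 2)].
Proof.
have al0 := alpha_gt0.
have d0 : 0 < 3 * alpha + 2 by lra.
have z0 : 0 < z by rewrite divr_gt0 //; lra.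
split.
- rewrite divr_gt0 //= /z_par ltr_pdivrMr // mul1r ltr_pdivrMr //; lra.
- by rewrite /gamma_par /z_par; field; lra.
- by rewrite /gamma_par /z_par; field; lra.
- by rewrite divr_ge0 ?(ltW z0) ?mulr_ge0 // ltW.
- by rewrite /z_par; field; lra.
Qed.

Lemma K_cocs_ge0 t : (0 < t)%N -> 0 <= K_cocs alpha t.
Proof. by move=> t0; rewrite mulr_ge0 ?powR_ge0 // ln_ge0 // ler1n. Qed.

Lemma K_cocs_le s t : (0 < s)%N -> (s <= t)%N -> K_cocs alpha s <= K_cocs alpha t.
Proof.
move=> s0 st; have [z12 _ _ _ _] := exponent_relations.
have z0 : 0 <= z by lra.
have t0 := leq_trans s0 st.
apply: ler_pM; rewrite ?powR_ge0 ?ln_ge0 ?ler1n //.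
- by apply: (ge0_ler_powR z0); rewrite ?nnegrE ?ler_nat.
- by rewrite ler_ln ?posrE ?ltr0n // ler_nat.
Qed.

(** Rounding up adds at most 1, and [1 <= T^gamma]. *)
Lemma h_cocs_bounds T : (0 < T)%N ->
  powR T%:R gamma <= (h_cocs alpha T)%:R <= 2 * powR T%:R gamma.
Proof.
move=> T0; have [_ _ _ g0 _] := exponent_relations.
have T1 : 1 <= T%:R :> R by rewrite ler1n.
have P1 : 1 <= powR T%:R gamma by rewrite -[leLHS](powRr0 T%:R); exact: ler_powR.
have c0 : 0 <= Num.ceil (powR T%:R gamma) by rewrite -(ler_int R);
  apply: le_trans (ceil_ge _); apply: le_trans P1.
have -> : (h_cocs alpha T)%:R = (Num.ceil (powR T%:R gamma))%:~R :> R.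
  by rewrite /h_cocs -[RHS](congr1 _ (gez0_abs c0)).
rewrite ceil_ge /=.
have := ltW (ceilB1_lt (powR T%:R gamma)); rewrite intrB; lra.
Qed.

(** The squared threshold [t^(- z)] cancels the power in [K], leaving [2 ln t] in the exponent. *)
Lemma deviation_exponent (t : nat) : (0 < t)%N ->
  expR (- (2 * powR t%:R (- (z / 2)) ^+ 2 * K_cocs alpha t)) = t%:R ^- 2.
Proof.
move=> t0; have tR : 0 < t%:R :> R by rewrite ltr0n.
have -> : powR t%:R (- (z / 2)) ^+ 2 = (powR t%:R z)^-1.
  rewrite -powR_mulrn ?powR_ge0 // -powRrM -powRN; congr powR; by field.
have -> : 2 * (powR t%:R z)^-1 * K_cocs alpha t = ln t%:R + ln t%:R.
  by rewrite /K_cocs; field; rewrite gt_eqF // powR_gt0.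
by rewrite expRN expRD lnK ?posrE // expr2.
Qed.

End Exponents.

(** * Summation over the rounds *)

Section Regret.
Variables (R : realType) (T N M : nat).
Variables (p : 'I_N -> 'I_M -> R * R -> R) (ctx : nat -> 'I_N -> 'I_M -> R * R).
Variables (sopt : nat -> decision N M) (sel : 'I_T -> outcome T N M -> decision N M).
Variables (h : nat) (Nset : nat -> 'I_M -> {set 'I_N}) (K : nat -> R).
Variables (cost : nat -> 'I_N -> R) (B beta : R) (b : nat).

Hypothesis M_gt0 : (0 < M)%N.
Hypothesis h_gt0 : (0 < h)%N.
Hypothesis mean01 : forall (i : 'I_T) x, 0 <= mean p ctx i x <= 1.
Hypothesis policy : cocs_policy sel ctx h Nset K cost B.
Hypothesis sopt_feasible : forall i : 'I_T,
  feasible (Nset i.+1) (cost i.+1) B (sopt i.+1).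
Hypothesis card_le : forall (i : 'I_T) s, feasible (Nset i.+1) (cost i.+1) B s ->
  forall m, (#|s m| <= b)%N.
Hypothesis K_ge0 : forall i : 'I_T, 0 <= K i.+1.
Hypothesis K_leT : forall i : 'I_T, K i.+1 <= K T.
Hypothesis KT_ge0 : 0 <= K T.
Hypothesis beta_ge0 : 0 <= beta.
Hypothesis bias : forall (i j : 'I_T) n m,
  cell h (ctx j.+1 n m) = cell h (ctx i.+1 n m) ->
  `|mean p ctx j (n, m) - mean p ctx i (n, m)| <= beta.

Lemma expected_regret_le (d : nat -> R) : (forall t, 0 <= d t) ->
  expected_regret p ctx sopt sel <=
  b%:R * (N%:R * M%:R * h%:R ^+ 2 * (K T + 1)
    + N%:R * M%:R * \sum_(i < T | (0 < i)%N) 2 * expR (- (2 * d i.+1 ^+ 2 * K i.+1))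
    + 2 * (\sum_(i < T) d i.+1 + T%:R * beta)).
Proof.
move=> d0.
pose under w (i : 'I_T) : R := (0 < n_under sel ctx h Nset K w i (sel i w))%N%:R.
pose dev (i : 'I_T) (x : 'I_N * 'I_M) w := deviates p ctx sel h K (d i.+1) i x.1 x.2 w.
have dev_le (i : 'I_T) x : expect p ctx (fun w => (dev i x w)%:R)
    <= if (0 < i)%N then 2 * expR (- (2 * d i.+1 ^+ 2 * K i.+1)) else 0.
  (* In the first round every counter is 0, hence not above [K], and the deviation event is
     empty. *)
  case: posnP => [i0|_];
    last by have := expect_deviation_le h mean01 policy.1 x.1 x.2 (cell h (ctx i.+1
      x.1 x.2)) (K i.+1) i (d0 i.+1).
  rewrite -[leRHS](expect_cst T p ctx) le_eqVlt; apply/orP; left; apply/eqP.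
  apply: eq_expect => w; rewrite /dev /deviates.
  have -> : counter sel ctx h w i x.1 x.2 (cell h (ctx i.+1 x.1 x.2)) = 0%N.
    by apply: eq_card0 => j; rewrite inE i0.
  by rewrite ltNge K_ge0.
have round (i : 'I_T) : expect p ctx (fun w => utility (sopt i.+1) (Xobs R w i))
    - expect p ctx (fun w => utility (sel i w) (Xobs R w i))
  <= b%:R * (expect p ctx (fun w => under w i) +
      N%:R * M%:R * (if (0 < i)%N then 2 * expR (- (2 * d i.+1 ^+ 2 * K i.+1)) else 0)
      + 2 * (d i.+1 + beta)).
  rewrite expect_utility_cst (expect_utility_sel p ctx policy.1).
  rewrite -[X in X - _](expect_cst T p ctx) -mulN1r -expectZ -expectD.
  apply: le_trans (_ : expect p ctx (fun w => b%:R * (under w i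
    + \sum_x (dev i x w)%:R + 2 * (d i.+1 + beta))) <= _).
    apply: le_expect => // w; rewrite mulN1r.
    by apply: (round_regret_le policy K_ge0 bias) => //; exact: card_le.
  rewrite expectZ ler_wpM2l // expectD expectD expect_cst lerD2r lerD2l expect_sum.
  apply: le_trans (ler_sum _ (fun x _ => dev_le i x)) _.
  by rewrite sumr_const card_prod !card_ord -[leLHS]mulr_natl natrM.
rewrite /expected_regret; apply: le_trans (ler_sum _ (fun i _ => round i)) _.
rewrite -mulr_sumr ler_wpM2l // !big_split /=; apply: lerD; first apply: lerD.
(* The count of exploration rounds is bounded for every outcome, hence in expectation. *)
- rewrite -expect_sum -[leRHS](expect_cst T p ctx); apply: le_expect => // w.
  exact: exploration_rounds_le.
- by rewrite -mulr_sumr -big_mkcond.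
- by rewrite -mulr_sumr big_split /= sumr_const card_ord -[beta *+ T]mulr_natl.
Qed.

End Regret.

(** * The explicit bound for the parameters of COCS *)

Theorem theorem2 (R : realType) (N M T : nat) (B L alpha : R)
  (Nset : nat -> 'I_M -> {set 'I_N})
  (c : 'I_N -> R -> R) (y : nat -> 'I_N -> R)
  (ctx : nat -> 'I_N -> 'I_M -> R * R)
  (p : 'I_N -> 'I_M -> R * R -> R)
  (cmin : R)
  (sopt : nat -> decision N M)
  (sel : 'I_T -> outcome T N M -> decision N M) :
  (0 < N)%N -> (0 < M)%N -> (1 <= T)%N ->
  0 < B -> 0 < L -> 0 < alpha ->
  (forall n, {homo c n : u v / u <= v}) ->
  (forall t n, 0 < c n (y t n)) ->
  (forall t n m, in_Phi (ctx t n m)) ->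
  (forall n m u, in_Phi u -> 0 <= p n m u <= 1) ->
  (forall n m u v, in_Phi u -> in_Phi v ->
     `|p n m u - p n m v| <= L * powR (dist2 u v) alpha) ->
  is_cmin T (fun t n => c n (y t n)) cmin ->
  (forall t, (1 <= t <= T)%N ->
     feasible (Nset t) (fun n => c n (y t n)) B (sopt t) /\
     forall s, feasible (Nset t) (fun n => c n (y t n)) B s ->
       utility s (fun n m => p n m (ctx t n m))
       <= utility (sopt t) (fun n m => p n m (ctx t n m))) ->
  cocs_policy sel ctx (h_cocs alpha T) Nset (K_cocs alpha)
    (fun t n => c n (y t n)) B ->
  expected_regret p ctx sopt sel <= regret_bound N M T B L alpha cmin.
Proof.
move=> N0 M0 T0 B0 L0 al0 _ c0 ctxP p01 hoelder [[t0 [n0 [_ cminE]]] cmin_le] soptP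
  policy.
have cmin0 : 0 < cmin by rewrite cminE.
have [z12 g2 ga g0 eE] := exponent_relations al0.
have T1 : 1 <= T%:R :> R by rewrite ler1n.
have TR : 0 < T%:R :> R by rewrite ltr0n.
have /andP[h_ge h_le] := h_cocs_bounds al0 T0.
have hR : 0 < (h_cocs alpha T)%:R :> R by apply: lt_le_trans h_ge; rewrite powR_gt0.
have h0 : (0 < h_cocs alpha T)%N by rewrite -(ltr0n R).
pose e := (2 * alpha + 2) / (3 * alpha + 2).
pose LL := L * powR 2 (alpha / 2).
have LL0 : 0 <= LL by rewrite mulr_ge0 ?powR_ge0 // ltW.
pose beta := LL * powR (h_cocs alpha T)%:R (- alpha).
have beta0 : 0 <= beta by rewrite mulr_ge0 ?powR_ge0.
(* From [h >= T^gamma] and [gamma * alpha = z / 2] follows [h^(- alpha) <= T^(- z / 2)]. *)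
have Tbeta : T%:R * beta <= LL * powR T%:R e.
  have -> : powR T%:R e = T%:R * powR T%:R (- (z_par alpha / 2)).
    rewrite /e -eE powRD ?powRr1 ?(ltW TR) //; by apply/implyP => _; rewrite gt_eqF.
  rewrite mulrCA ler_wpM2l // ler_wpM2l ?(ltW TR) // !powRN.
  rewrite lef_pV2 ?posrE ?powR_gt0 // -ga powRrM.
  by apply: (ge0_ler_powR (ltW al0)); rewrite ?nnegrE ?powR_ge0 ?(ltW hR).
pose b := Num.truncn (B / cmin).
have rho0 : 0 < B / cmin by rewrite divr_gt0.
have b_le : b%:R <= B / cmin by have /andP[] := truncn_itv (ltW rho0).
pose d (t : nat) : R := powR t%:R (- (z_par alpha / 2)).
have H : expected_regret p ctx sopt sel <=
  b%:R * (N%:R * M%:R * (h_cocs alpha T)%:R ^+ 2 * (K_cocs alpha T + 1)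
    + N%:R * M%:R * \sum_(i < T | (0 < i)%N) 2 * expR (- (2 * d i.+1 ^+ 2 * K_cocs
      alpha i.+1))
    + 2 * (\sum_(i < T) d i.+1 + T%:R * beta)).
  apply: (expected_regret_le M0 h0 _ policy) => //.
  - by move=> i x; exact: p01.
  - by move=> i; case: (soptP i.+1); rewrite //= ltn_ord.
  - move=> i s fs m; apply: feasible_card fs => // n; apply: cmin_le => /=;
      exact: ltn_ord.
  - by move=> i; exact: K_cocs_ge0.
  - by move=> i; apply: K_cocs_le => //; exact: ltn_ord.
  - exact: K_cocs_ge0.
  - move=> i j n m ce; apply: le_trans (hoelder _ _ _ _ _ _) _;
      rewrite // /beta -mulrA ler_wpM2l ?(ltW L0) //.
    exact: dist2_cell_le.
  - by move=> t; exact: powR_ge0.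
apply: le_trans H _.
have NM0 : 0 <= N%:R * M%:R :> R by exact: mulr_ge0.
have N1 : 1 <= N%:R :> R by rewrite ler1n.
have M1 : 1 <= M%:R :> R by rewrite ler1n.
have NM1 : 1 <= N%:R * M%:R :> R by rewrite -[leLHS]mulr1 ler_pM.
have e0 : 0 < e by rewrite divr_gt0; lra.
(* For [b = 0] the left side vanishes; otherwise the term [k = 1] equals [N >= 1], so the binomial
   sum is at least 1. *)
have bT : b%:R <= B / cmin * \sum_(1 <= k < b.+1) ('C(N, k))%:R.
  case: (posnP b) => [->|b0].
    by rewrite mulr_ge0 ?(ltW rho0) // sumr_ge0.
  apply: le_trans b_le _; rewrite -[leLHS]mulr1 ler_wpM2l ?(ltW rho0) //.
  rewrite big_ltn // bin1 -[leLHS]addr0 lerD // sumr_ge0 //.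
rewrite /regret_bound -/e -/LL -/b [leLHS]mulrDr; apply: lerD;
  first (rewrite [leLHS]mulrDr; apply: lerD).
- have lnT : 0 <= ln T%:R :> R by rewrite ln_ge0.
  have KT0 := K_cocs_ge0 alpha T0.
  (* The factor 4 is the square of the rounding factor in [h <= 2 T^gamma], and the powers of [T]
     combine by [e = 2 gamma + z]. *)
  have step : (h_cocs alpha T)%:R ^+ 2 * (K_cocs alpha T + 1) <=
      4 * (ln T%:R * powR T%:R e + powR T%:R (2 / (3 * alpha + 2))).
    have -> : ln T%:R * powR T%:R e + powR T%:R (2 / (3 * alpha + 2))
        = powR T%:R (gamma_par alpha) ^+ 2 * (K_cocs alpha T + 1).
      rewrite -powR_mulrn ?powR_ge0 // -powRrM g2 /K_cocs mulrDr mulr1; congr (_ + _).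
      have -> : e = 2 / (3 * alpha + 2) + z_par alpha by rewrite /e /z_par; field; lra.
      rewrite powRD; first by ring.
      by apply/implyP => _; rewrite gt_eqF.
    rewrite mulrA ler_wpM2r ?addr_ge0 //.
    have -> : 4 * powR T%:R (gamma_par alpha) ^+ 2 = (2 * powR T%:R (gamma_par
      alpha)) ^+ 2 by ring.
    by rewrite lerXn2r ?nnegrE ?(ltW hR) ?mulr_ge0 ?powR_ge0.
  have X0 : 0 <= 4 * (ln T%:R * powR T%:R e + powR T%:R (2 / (3 * alpha + 2))).
    by rewrite !(mulr_ge0, addr_ge0, powR_ge0).
  apply: le_trans (_ : B / cmin * (N%:R * M%:R * (4 * (ln T%:R * powR T%:R e + powR
    T%:R (2 / (3 * alpha + 2))))) <= _).
    rewrite -[N%:R * M%:R * _ * _]mulrA ler_pM ?(ler_wpM2l NM0 step) //.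
    by rewrite (mulr_ge0 NM0) // mulr_ge0 ?exprn_ge0 ?addr_ge0 ?(ltW hR).
  (* The second factor [N] of the stated term comes from [1 <= N]. *)
  rewrite -[leLHS]mul1r; apply: le_trans (ler_wpM2r _ N1) _.
    exact: mulr_ge0 (ltW rho0) (mulr_ge0 NM0 X0).
  by rewrite le_eqVlt; apply/orP; left; apply/eqP; ring.
(* The bound [2 <= pi] is enough for [2 * (2 / 3) <= pi ^+ 2 / 3]. *)
- have pi4 : 4 <= pi ^+ 2 :> R by have := @pi_ge2 R => ?;
    rewrite -[4](_ : 2 ^+ 2 = _) ?lerXn2r ?nnegrE; lra.
  have sum_le : \sum_(i < T | (0 < i)%N) 2 * expR (- (2 * d i.+1 ^+ 2 * K_cocs alpha
    i.+1)) <= pi ^+ 2 / 3.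
    under eq_bigr do rewrite deviation_exponent //.
    rewrite -mulr_sumr; have := sum_inv_sqr_le R T; lra.
  apply: le_trans (_ : (B / cmin * \sum_(1
    <= k < b.+1) ('C(N, k))%:R) * (N%:R * M%:R * (pi ^+ 2 / 3)) <= _).
    rewrite ler_pM //; first by rewrite mulr_ge0 // sumr_ge0 // => i _;
      rewrite mulr_ge0 ?expR_ge0.
    by rewrite ler_wpM2l.
  by rewrite le_eqVlt; apply/orP; left; apply/eqP; ring.
(* Noise and bias contribute the coefficients [2 / e] and [2 LL] of [T^e], together at most
   [3 LL + (2 + 2 LL) / e]. *)
- have Td : \sum_(i < T) d i.+1 <= powR T%:R e / e by have := sum_powRN_le T z12;
    rewrite eE.
  have P0 : 0 <= powR T%:R e by exact: powR_ge0.
  have sd0 : 0 <= \sum_(i < T) d i.+1 by apply: sumr_ge0 => i _; exact: powR_ge0.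
  have Pe0 : 0 <= powR T%:R e / e by rewrite divr_ge0 // ltW.
  apply: le_trans (_ : (B / cmin) * (2 * (powR T%:R e / e + LL * powR T%:R e)) <= _).
    have TB0 : 0 <= T%:R * beta by exact: mulr_ge0.
    by rewrite ler_pM ?(mulr_ge0 _ (addr_ge0 sd0 TB0)) // ler_wpM2l // lerD.
  apply: le_trans (_ : (N%:R * M%:R * (B / cmin)) * (3 * LL * powR T%:R e + (2 + 2 *
    LL) * (powR T%:R e / e)) <= _).
    have LP0 := mulr_ge0 LL0 P0; have LPe0 := mulr_ge0 LL0 Pe0.
    apply: ler_pM; rewrite ?(ltW rho0) ?(mulr_ge0 _ (addr_ge0 Pe0 LP0)) //; last lra.
    by rewrite -[leLHS]mul1r ler_wpM2r // ltW.
  by rewrite le_eqVlt; apply/orP; left; apply/eqP; ring.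
Qed.
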